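(* Let $G$ be a graph and $M\subseteq V(G)$ a connected module of $G$. Then $M$ is a module of every minimum interval supergraph of $G$.
   Context: Graphs are finite, simple, undirected. A set $M\subseteq V(G)$ is a module of $G$ if every vertex outside $M$ is adjacent either to all vertices of $M$ or to none of them; it is a connected module if moreover $G[M]$ is connected. An interval supergraph of $G$ is an interval graph $\widehat G$ with $V(\widehat G)=V(G)$ and $E(G)\subseteq E(\widehat G)$; it is minimum if it has the minimum number of edges among all interval supergraphs of $G$. *)

(* Defs.v *)
From mathcomp Require Import all_boot all_order all_algebra.
From mathcomp Require Import reals.

Set Implicit Arguments.
Unset Strict Implicit.
Unset Printing Implicit Defensive.

Local Open Scope ring_scope.

Record sgraph (T : finType) := SGraph {
  adj :> rel T;
  adj_sym : symmetric adj;
  adj_irr : irreflexive adj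
}.

Definition edges (T : finType) (G : sgraph T) : {set {set T}} :=
  [set [set p.1; p.2] | p in [set p : T * T | G p.1 p.2]].

Definition is_module (T : finType) (G : sgraph T) (M : {set T}) : Prop :=
  forall v, v \notin M ->
    (forall x, x \in M -> G v x) \/ (forall x, x \in M -> ~~ G v x).

Definition induced_rel (T : finType) (G : sgraph T) (M : {set T}) : rel T :=
  [rel x y | [&& x \in M, y \in M & G x y]].

(* Under this definition the empty set is connected. *)
Definition induces_connected (T : finType) (G : sgraph T) (M : {set T}) : Prop :=
  forall x y, x \in M -> y \in M -> connect (induced_rel G M) x y.

Definition connected_module (T : finType) (G : sgraph T) (M : {set T}) : Prop :=
  is_module G M /\ induces_connected G M.

(* G is the intersection graph of nonempty closed intervals [l v, r v] of the
   real line. *)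
Definition interval_graph (R : realType) (T : finType) (G : sgraph T) : Prop :=
  exists l r : T -> R,
    (forall v, l v <= r v) /\
    (forall u v, u != v ->
       (G u v <-> exists x : R, x \in `[l u, r u] /\ x \in `[l v, r v])).

Definition interval_supergraph (R : realType) (T : finType)
    (G H : sgraph T) : Prop :=
  interval_graph R H /\ edges G \subset edges H.

Definition minimum_interval_supergraph (R : realType) (T : finType)
    (G H : sgraph T) : Prop :=
  interval_supergraph R G H /\
  forall H' : sgraph T, interval_supergraph R G H' ->
    (#|edges H| <= #|edges H'|)%N.

(* Main.v *)
Require Import Defs.
From mathcomp Require Import all_boot all_order all_algebra.
From mathcomp Require Import reals boolp lra.

(** Fix an interval representation of [H], let [a] be the least right endpoint
    and [b] the greatest left endpoint of an interval of [M].  Every interval of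
    [M], and every interval of a [G]-neighbour of [M], meets the segment spanned
    by [a] and [b].

    If [b <= a], the intervals of [M] share [[b, a]]; shrinking all of them to
    that segment loses no edge of [G], so minimality says nothing was lost, and
    [M] has become a set of twins.

    If [a < b], all [G]-neighbours of [M] contain [[a, b]].  Choose [x] in
    [[a, b]] covered by the fewest intervals outside [M], cut the line at [x]
    and insert there a copy of the representation of [H[M]].  No vertex of [M]
    then has more outside neighbours than before, so by minimality each had
    exactly as many as there are intervals outside [M] covering [x].
    Two intersecting intervals of [M] meet inside [[a, b]] by Helly, and the
    intervals covering a common point there already exhaust the outside
    neighbours of both; connectivity of [M] finishes the proof. *)

Set Implicit Arguments.
Unset Strict Implicit.
Unset Printing Implicit Defensive.

Import Order.TTheory GRing.Theory Num.Theory.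
Local Open Scope ring_scope.

(** * Counting edges *)

Lemma mem_edges (T : finType) (G : sgraph T) x y :
  ([set x; y] \in edges G) = G x y.
Proof.
apply/imsetP/idP => [[[a b]]|Gxy]; last by exists (x, y); rewrite ?inE.
rewrite inE /= => Gab e.
have : x \in [set a; b] by rewrite -e !inE eqxx.
have : y \in [set a; b] by rewrite -e !inE eqxx orbT.
have : a \in [set x; y] by rewrite e !inE eqxx.
have : b \in [set x; y] by rewrite e !inE eqxx orbT.
rewrite !inE; have nab : a != b by apply: contraTneq Gab => ->; rewrite adj_irr.
move=> hb ha /orP[]/eqP ey /orP[]/eqP ex; subst x y => //.
- by move: hb; rewrite orbb eq_sym (negbTE nab).
- by rewrite adj_sym.
- by move: ha; rewrite orbb (negbTE nab).
Qed.

Lemma edges_subP (T : finType) (G H : sgraph T) :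
  reflect (forall x y, G x y -> H x y) (edges G \subset edges H).
Proof.
apply: (iffP subsetP) => [sGH x y | GH e].
  by rewrite -!mem_edges; apply: sGH.
by case/imsetP=> -[x y]; rewrite inE /= => /GH; rewrite -mem_edges => + ->.
Qed.

Lemma sum_degrees (T : finType) (G : sgraph T) :
  (\sum_x \sum_y (G x y : nat) = 2 * #|edges G|)%N.
Proof.
pose h (p : T * T) := [set p.1; p.2].
pose A := [set p : T * T | G p.1 p.2].
have -> : (\sum_x \sum_y (G x y : nat) = \sum_(p in A) 1)%N.
  rewrite pair_big /= [RHS]big_mkcond /=; apply: eq_bigr => p _.
  by rewrite inE; case: (G _ _).
rewrite (partition_big_imset h) /= -/(edges G) mulnC -sum_nat_const.
apply: eq_bigr => e /imsetP[[x y]]; rewrite inE /= => Gxy ->.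
have nxy : x != y by apply: contraTneq Gxy => ->; rewrite adj_irr.
(* The fibre over an edge consists of its two orientations, which differ since there are no
   loops. *)
rewrite sum1dep_card (_ : [set _ | _] = [set (x, y); (y, x)]).
  by rewrite cards2 xpair_eqE (negbTE nxy).
apply/setP=> -[a b]; rewrite !inE !xpair_eqE /h /=; apply/andP/orP.
  case=> Gab /eqP e2; have nab : a != b.
    by apply: contraTneq Gab => ->; rewrite adj_irr.
  have := set21 a b; have := set22 a b; rewrite e2 !inE.
  move=> /orP[]/eqP eb /orP[]/eqP ea; subst a b; rewrite ?eqxx ?andbT;
    by [left | right | rewrite eqxx in nab].
case=> /andP[/eqP-> /eqP->]; split=> //; first by rewrite adj_sym.
by rewrite setUC.
Qed.

Definition outer_nbhd (T : finType) (H : sgraph T) (M : {set T}) (u : T) :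
  {set T} := [set v | (v \notin M) && H u v].

(** The degree sum splits into four blocks, and symmetry of [H] makes the two mixed blocks equal.
    Replacing the intervals of [M] will affect only the last term. *)
Lemma card_edges_split (T : finType) (H : sgraph T) (M : {set T}) :
  (2 * #|edges H| =
     \sum_(x in M) \sum_(y in M) (H x y : nat)
     + \sum_(x | x \notin M) \sum_(y | y \notin M) (H x y : nat)
     + 2 * \sum_(x in M) #|outer_nbhd H M x|)%N.
Proof.
rewrite -sum_degrees (bigID (mem M)) /=.
under eq_bigr do rewrite (bigID (mem M)) /=.
under [X in (_ + X)%N]eq_bigr do rewrite (bigID (mem M)) /=.
rewrite !big_split /=.
rewrite [X in (_ + (X + _))%N]exchange_big /=.
have -> : (\sum_(j in M) \sum_(i | i \notin M) (H i j : nat)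
    = \sum_(i in M) \sum_(j | j \notin M) (H i j : nat))%N.
  by apply: eq_bigr => i _; apply: eq_bigr => j _; rewrite adj_sym.
have -> : (\sum_(i in M) \sum_(j | j \notin M) (H i j : nat)
    = \sum_(x in M) #|outer_nbhd H M x|)%N.
  apply: eq_bigr => i _; rewrite -sum1dep_card [RHS]big_mkcondr /=.
  by apply: eq_bigr => j _; case: (H _ _).
by rewrite mul2n -addnn -!addnA; congr addn; rewrite addnA addnC.
Qed.

Lemma eq_outer_nbhd_is_module (T : finType) (H : sgraph T) (M : {set T}) :
  {in M &, forall u w, outer_nbhd H M u = outer_nbhd H M w} -> is_module H M.
Proof.
move=> eqN v vM.
have [/existsP[u /andP[uM Hvu]]|] := boolP [exists u, (u \in M) && H v u].
  left=> w wM; have /setP/(_ v) := eqN u w uM wM.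
  by rewrite !inE vM /= adj_sym Hvu [RHS]adj_sym => <-.
rewrite negb_exists => /forallP noN; right=> x xM.
by have := noN x; rewrite xM.
Qed.

(** The two graphs can differ only between [M] and its complement, so minimality bounds the sum of
    outer degrees in [H] by that in [H']. The termwise bounds go the other way, hence each is an
    equality. *)
Lemma minimum_outer_nbhd (R : realType) (T : finType) (G H H' : sgraph T)
    (M : {set T}) :
  minimum_interval_supergraph R G H -> interval_supergraph R G H' ->
  {in M &, H' =2 H} ->
  (forall u v, u \notin M -> v \notin M -> H' u v = H u v) ->
  (forall u, u \in M -> #|outer_nbhd H' M u| <= #|outer_nbhd H M u|)%N ->
  forall u, u \in M -> #|outer_nbhd H' M u| = #|outer_nbhd H M u|.
Proof.
move=> [_ minH] /minH le_e inM outM le_c.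
have le : (\sum_(u in M) #|outer_nbhd H M u|
           <= \sum_(u in M) #|outer_nbhd H' M u|)%N.
  move: le_e; rewrite -(leq_pmul2l (isT : 0 < 2)%N) !(card_edges_split _ M).
  rewrite [X in (_ <= X + _ + _)%N](_ : _ =
    \sum_(x in M) \sum_(y in M) (H x y : nat))%N; last first.
    by apply: eq_bigr => x xM; apply: eq_bigr => y yM; rewrite inM.
  rewrite [X in (_ <= _ + X + _)%N](_ : _ =
    \sum_(x | x \notin M) \sum_(y | y \notin M) (H x y : nat))%N; last first.
    by apply: eq_bigr => x xM; apply: eq_bigr => y yM; rewrite outM.
  by rewrite leq_add2l leq_pmul2l.
have ifle : forall u, u \in M -> (#|outer_nbhd H' M u| <= #|outer_nbhd H M u|
    ?= iff (#|outer_nbhd H' M u| == #|outer_nbhd H M u|))%N.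
  by move=> u uM; split; [apply: le_c|].
have := leqif_sum ifle; case=> le2 /esym.
by rewrite eqn_leq le2 le => /forall_inP eqc u uM; apply/eqP/eqc.
Qed.

(** * Graphs given by interval endpoints *)

Lemma interval_meetP (R : realDomainType) (a b c d : R) : a <= b -> c <= d ->
  (exists x, x \in `[a, b] /\ x \in `[c, d]) <-> (a <= d) && (c <= b).
Proof.
move=> ab cd; split=> [[x []]|/andP[ad cb]].
  rewrite !in_itv /= => /andP[ax xb] /andP[cx xd].
  by rewrite (le_trans ax xd) (le_trans cx xb).
by case: (leP a c) => ac; [exists c | exists a];
  rewrite !in_itv /= ?lexx ?ab ?cd ?ad ?cb ?ac ?(ltW ac).
Qed.

Lemma endpoints_sym (R : realDomainType) (T : finType) (l r : T -> R) :
  symmetric [rel u v | [&& u != v, l u <= r v & l v <= r u]].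
Proof. by move=> u v /=; rewrite eq_sym; congr andb; rewrite andbC. Qed.

Lemma endpoints_irr (R : realDomainType) (T : finType) (l r : T -> R) :
  irreflexive [rel u v | [&& u != v, l u <= r v & l v <= r u]].
Proof. by move=> u /=; rewrite eqxx. Qed.

(** Intersection is encoded by endpoint inequalities, which makes adjacency boolean and accessible
    to linear arithmetic. *)
Definition endpoints_graph (R : realDomainType) (T : finType) (l r : T -> R) :=
  SGraph (@endpoints_sym R T l r) (@endpoints_irr R T l r).

Lemma endpoints_interval_graph (R : realType) (T : finType) (l r : T -> R) :
  (forall v, l v <= r v) -> interval_graph R (endpoints_graph l r).
Proof.
move=> lr; exists l, r; split=> // u v uv.
by rewrite interval_meetP //= uv.
Qed.

Lemma interval_graph_endpoints (R : realType) (T : finType) (H : sgraph T) :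
  interval_graph R H -> exists l r : T -> R,
    (forall v, l v <= r v) /\
    (forall u v, H u v = [&& u != v, l u <= r v & l v <= r u]).
Proof.
move=> [l [r [lr Hlr]]]; exists l, r; split=> // u v.
have [->|uv] := eqVneq u v; first by rewrite adj_irr.
by apply/idP/idP; [move/(Hlr u v uv) | move=> h; apply/(Hlr u v uv)];
  rewrite ?interval_meetP // => /interval_meetP; apply.
Qed.

(** * Replacing the intervals of a module *)

Lemma clique_module (R : realType) (T : finType) (G H : sgraph T)
    (M : {set T}) (l r : T -> R) (a b : R) :
  is_module G M -> minimum_interval_supergraph R G H ->
  (forall v, l v <= r v) ->
  (forall u v, H u v = [&& u != v, l u <= r v & l v <= r u]) ->
  (exists2 u, u \in M & r u = a) -> (exists2 u, u \in M & l u = b) ->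
  (forall u, u \in M -> a <= r u /\ l u <= b) -> b <= a -> is_module H M.
Proof.
move=> modG minH lr Hlr [ua uaM ra] [ub ubM lb] ab_ext ba.
pose l' u := if u \in M then b else l u.
pose r' u := if u \in M then a else r u.
pose H' := endpoints_graph l' r'.
(* Both graphs are complete on [M], since every interval of [M] contains [[b, a]]. *)
have inM : {in M &, H' =2 H}.
  move=> u v uM vM; rewrite Hlr /= /l' /r' uM vM ba /=.
  have [? ?] := ab_ext u uM; have [? ?] := ab_ext v vM.
  have -> : l u <= r v by lra.
  by have -> : l v <= r u by lra.
have outM u v : u \notin M -> v \notin M -> H' u v = H u v.
  by move=> uM vM; rewrite Hlr /= /l' /r' (negbTE uM) (negbTE vM).
have crossM u v : u \in M -> v \notin M ->
    H' u v = (b <= r v) && (l v <= a).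
  move=> uM vM; rewrite /= /l' /r' uM (negbTE vM).
  by rewrite (_ : u != v) //; apply: contraNneq vM => <-.
have GH : forall x y, G x y -> H x y by apply/edges_subP; case: minH => -[].
have crossG u v : u \in M -> v \notin M -> G u v -> H' u v.
  move=> uM vM Guv; rewrite crossM //.
  (* A [G]-neighbour of [M] is adjacent to [ua], whose interval ends at [a], and to [ub], whose
     interval starts at [b]; so it meets [[b, a]]. *)
  have [all|none] := modG v vM; last first.
    by have := none u uM; rewrite adj_sym Guv.
  have := GH _ _ (all _ uaM); rewrite Hlr ra => /and3P[_ -> _].
  by have := GH _ _ (all _ ubM); rewrite Hlr lb andbT => /and3P[_ _ ->].
have supH' : interval_supergraph R G H'.
  split.
    apply: endpoints_interval_graph => v; rewrite /l' /r'.
    by case: ifP.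
  apply/edges_subP => x y Gxy.
  have [xM|xM] := boolP (x \in M); have [yM|yM] := boolP (y \in M).
  - by rewrite inM // GH.
  - exact: crossG.
  - by rewrite adj_sym crossG // adj_sym.
  - by rewrite outM // GH.
have subN u : u \in M -> outer_nbhd H' M u \subset outer_nbhd H M u.
  move=> uM; apply/subsetP => v; rewrite !inE => /andP[vM].
  rewrite vM crossM // Hlr /= => /andP[h1 h2]; have [? ?] := ab_ext u uM.
  apply/and3P; split; [by apply: contraNneq vM => <- | lra | lra].
have eqN u : u \in M -> outer_nbhd H M u = outer_nbhd H' M u.
  move=> uM; apply/esym/eqP; rewrite eqEcard subN //=.
  rewrite (minimum_outer_nbhd minH supH' inM outM _ uM) // => w wM.
  by apply: subset_leq_card; apply: subN.
apply: eq_outer_nbhd_is_module => u w uM wM; rewrite !eqN //.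
apply/setP=> v; rewrite !inE; have [//|vM /=] := boolP (v \in M).
by rewrite -[LHS]/(H' u v) -[RHS]/(H' w v) !crossM.
Qed.

(* The line is cut at [x], the right part is moved by [2 * c], and the
   intervals of [M], which lie in [[- c, c]], are moved into the gap. *)
Lemma insert_module (R : realType) (T : finType) (H : sgraph T) (M : {set T})
    (l r : T -> R) (x : R) :
  (forall v, l v <= r v) ->
  (forall u v, H u v = [&& u != v, l u <= r v & l v <= r u]) ->
  exists H' : sgraph T, [/\ interval_graph R H', {in M &, H' =2 H},
    (forall u v, u \notin M -> v \notin M -> H' u v = H u v) &
    (forall u v, u \in M -> v \notin M -> H' u v = (l v <= x <= r v))].
Proof.
move=> lr Hlr.
pose c := \sum_v (`|l v| + `|r v|).
have c_bd v : - c <= l v /\ r v <= c.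
  have le_c : `|l v| + `|r v| <= c.
    by rewrite /c (bigD1 v) //= lerDl sumr_ge0 // => i _; rewrite addr_ge0.
  have := normr_ge0 (l v); have := normr_ge0 (r v).
  by have := ler_norm (r v); have := ler_norm (- l v); rewrite normrN; lra.
(* Both tests are non-strict: an interval outside [M] that contains [x], even as an endpoint, is
   stretched over the whole gap from [x] to [x + 2 * c]. Any other stays wholly on one side of
   it. *)
pose l' u := if u \in M then x + c + l u
             else if l u <= x then l u else l u + 2 * c.
pose r' u := if u \in M then x + c + r u
             else if x <= r u then r u + 2 * c else r u.
have c0 : 0 <= c by rewrite sumr_ge0 // => v _; rewrite addr_ge0.
have shift u v : u \notin M -> v \notin M -> (l' u <= r' v) = (l u <= r v).
  rewrite /l' /r' => /negbTE-> /negbTE->.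
  by case: (leP (l u) x) => ?; case: (leP x (r v)) => ?; apply/idP/idP; lra.
have l'r' v : l' v <= r' v.
  have [vM|vM] := boolP (v \in M); last by rewrite shift.
  by rewrite /l' /r' vM lerD2l.
exists (endpoints_graph l' r'); split.
- exact: endpoints_interval_graph.
- by move=> u v uM vM; rewrite Hlr /= /l' /r' uM vM !lerD2l.
- by move=> u v uM vM; rewrite Hlr /= !shift.
move=> u v uM vM; have uv : u != v by apply: contraNneq vM => <-.
rewrite /= uv /l' /r' uM (negbTE vM) /=.
have [? ?] := c_bd u; have := lr u; have := lr v => ? ?.
by case: (leP (l v) x) => ?; case: (leP x (r v)) => ?;
  rewrite ?andbF /=; apply/idP/idP => //; lra.
Qed.

(** The domain may be infinite, here a segment of the line: the attained values are natural numbers,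
    so a least one exists. *)
Lemma ex_minimizer (X : Type) (P : X -> Prop) (f : X -> nat) :
  (exists x, P x) -> exists2 x, P x & forall y, P y -> (f x <= f y)%N.
Proof.
case=> x0 Px0.
have exP : exists n, `[< exists2 x, P x & f x = n >].
  by exists (f x0); apply/asboolP; exists x0.
case: (ex_minnP exP) => n /asboolP[x Px <-] minn; exists x => // y Py.
by apply: minn; apply/asboolP; exists y.
Qed.

Lemma nonclique_module (R : realType) (T : finType) (G H : sgraph T)
    (M : {set T}) (l r : T -> R) (a b : R) :
  connected_module G M -> minimum_interval_supergraph R G H ->
  (forall v, l v <= r v) ->
  (forall u v, H u v = [&& u != v, l u <= r v & l v <= r u]) ->
  (exists2 u, u \in M & r u = a) -> (exists2 u, u \in M & l u = b) ->
  (forall u, u \in M -> a <= r u /\ l u <= b) -> a < b -> is_module H M.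
Proof.
move=> [modG conG] minH lr Hlr [ua uaM ra] [ub ubM lb] ab_ext ab.
pose cover y := [set v | (v \notin M) && (l v <= y <= r v)].
have [|x /andP[ax xb] minx] :=
    @ex_minimizer R (fun y => a <= y <= b) (fun y => #|cover y|).
  by exists a; rewrite lexx ltW.
have [H' [itvH' inM outM crossM]] := insert_module M x lr Hlr.
have GH : forall u v, G u v -> H u v by apply/edges_subP; case: minH => -[].
have crossG u v : u \in M -> v \notin M -> G u v -> H' u v.
  move=> uM vM Guv; rewrite crossM //.
  have [all|none] := modG v vM; last first.
    by have := none u uM; rewrite adj_sym Guv.
  have := GH _ _ (all _ uaM); rewrite Hlr ra => /and3P[_ ? _].
  by have := GH _ _ (all _ ubM); rewrite Hlr lb => /and3P[_ _ ?]; lra.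
have supH' : interval_supergraph R G H'.
  split=> //; apply/edges_subP => u v Guv.
  have [uM|uM] := boolP (u \in M); have [vM|vM] := boolP (v \in M).
  - by rewrite inM // GH.
  - exact: crossG.
  - by rewrite adj_sym crossG // adj_sym.
  - by rewrite outM // GH.
have coverH' u : u \in M -> outer_nbhd H' M u = cover x.
  move=> uM; apply/setP=> v; rewrite !inE.
  by have [//|vM /=] := boolP (v \in M); rewrite crossM.
have coverH u y : u \in M -> l u <= y <= r u ->
    cover y \subset outer_nbhd H M u.
  move=> uM /andP[ly yr]; apply/subsetP => v; rewrite !inE.
  case/andP=> vM /andP[? ?]; rewrite vM Hlr /=.
  by apply/and3P; split; [apply: contraNneq vM => <- | lra | lra].
have cardH u : u \in M -> #|outer_nbhd H M u| = #|cover x|.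
  move=> uM; rewrite -(coverH' u uM).
  apply/esym/(minimum_outer_nbhd minH supH' inM outM _ uM) => w wM.
  have [? ?] := ab_ext w wM; rewrite coverH' //.
  (* A point common to [[a, b]] and the interval of [w]; the choice of [x] gives [cover y] at least
     as many elements as [cover x]. *)
  pose y := Num.max a (l w); have := lr w => ?.
  apply: leq_trans (subset_leq_card (coverH w y wM _)).
    by apply: minx; rewrite /y; case: (leP a (l w)) => ?; lra.
  by rewrite /y; case: (leP a (l w)) => ?; lra.
(* [cover y] lies in a set of size [#|cover x|] and is itself at least that large. *)
have eqN u y : u \in M -> a <= y <= b -> l u <= y <= r u ->
    outer_nbhd H M u = cover y.
  move=> uM aby luy; apply/esym/eqP.
  by rewrite eqEcard coverH //= cardH // minx.
have eqNadj u w : u \in M -> w \in M -> H u w ->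
    outer_nbhd H M u = outer_nbhd H M w.
  move=> uM wM; rewrite Hlr => /and3P[_ ? ?].
  have [? ?] := ab_ext u uM; have [? ?] := ab_ext w wM.
  have ? := lr u; have ? := lr w.
  (* Helly on the line: [[a, b]] and the intervals of [u] and [w] meet pairwise, so the greatest
     left endpoint lies in all three. *)
  pose y := Num.max a (Num.max (l u) (l w)).
  have y_ok : [/\ a <= y <= b, l u <= y <= r u & l w <= y <= r w].
    rewrite /y; case: (leP (l u) (l w)) => ?.
      by case: (leP a (l w)) => ?; split; lra.
    by case: (leP a (l u)) => ?; split; lra.
  by case: y_ok => aby uy wy; rewrite (eqN u y) // (eqN w y).
apply: eq_outer_nbhd_is_module => u w uM wM.
have /connectP[p] := conG u w uM wM.
(* Equality propagates along a path of [G[M]], whose edges are also edges of [H]. *)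
elim: p u uM => [|v p IHp] u uM /=; first by move=> _ ->.
case/andP=> /and3P[_ vM /GH Huv] pth ew.
by rewrite (eqNadj u v) // IHp.
Qed.

Theorem theorem3 (R : realType) (T : finType) (G : sgraph T) (M : {set T}) :
  connected_module G M ->
  forall H : sgraph T, minimum_interval_supergraph R G H -> is_module H M.
Proof.
move=> cM H minH.
(* The extremal endpoints need an element of [M] to exist. *)
have [->|[u0 u0M]] := set_0Vmem M; first by move=> v _; left=> x; rewrite inE.
have [l [r [lr Hlr]]] : exists l r : T -> R, (forall v, l v <= r v) /\
    (forall u v, H u v = [&& u != v, l u <= r v & l v <= r u]).
  by apply: interval_graph_endpoints; case: minH => -[].
have [ua uaM ua_min] := arg_minP r u0M.
have [ub ubM ub_max] := arg_maxP l u0M.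
have ext u : u \in M -> r ua <= r u /\ l u <= l ub.
  by move=> uM; split; [apply: ua_min | apply: ub_max].
have exa : exists2 u, u \in M & r u = r ua by exists ua.
have exb : exists2 u, u \in M & l u = l ub by exists ub.
have [ba|ab] := leP (l ub) (r ua).
  exact: (clique_module cM.1 minH lr Hlr exa exb ext ba).
exact: (nonclique_module cM minH lr Hlr exa exb ext ab).
Qed.
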